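(* Suppose that $E$ is a realizable matrix of rank $1$: $$ E=\begin{bmatrix} J_{k_1,k_2} & -J_{k_1,k_2} & 0\\ -J_{k_1,k_2} & J_{k_1,k_2} & 0\\ 0 & 0 & 0 \end{bmatrix} $$ for some $k_1, k_2>0$. Let $A=\begin{bmatrix} 0 & J_{k_1,k_2} & X_1\\ J_{k_1,k_2} & 0 & X_2\\ X_3 & X_4 & Y \end{bmatrix}$ be a $(0,1)$ matrix compatible with the partition of $E$. Then, we have the following: \begin{enumerate} \item $A$ and $A+E$ are Gram mates if and only if $\mathbf{1}^TX_1=\mathbf{1}^TX_2$ and $X_3\mathbf{1}=X_4\mathbf{1}$. \item $E$ is realizable. \item For any Gram mates via $E$, they are convertible to each other. \item For any Gram mates via $E$, their Gram singular value is $\sqrt{k_1k_2}$, and the corresponding left and right singular vectors are (up to sign) $\frac{1}{\sqrt{2k_1}}\begin{bmatrix} -\mathbf{1}_{k_1}\\\mathbf{1}_{k_1}\\0\end{bmatrix}$ and $\frac{1}{\sqrt{2k_2}}\begin{bmatrix} \mathbf{1}_{k_2}\\-\mathbf{1}_{k_2}\\0\end{bmatrix}$, respectively. \end{enumerate}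
   Context: $J_{p,q}$ denotes the $p\times q$ all-ones matrix and $\mathbf{1}_n$ the all-ones column vector of length $n$. Two $(0,1)$ matrices $A\neq B$ are Gram mates if $AA^T=BB^T$ and $A^TA=B^TB$. A $(0,1,-1)$ matrix $E$ with $E\mathbf{1}=0$, $\mathbf{1}^TE=0^T$ is realizable if there is a pair of Gram mates $A$, $A+E$; $A$ and $B$ are Gram mates via $E$ if they are Gram mates and $A-B=\pm E$. A $(0,1)$ matrix $A$ is convertible to a $(0,1)$ matrix $B$ if $B$ is obtained from a singular value decomposition $A=U\Sigma V^T$ by changing the signs of some $k\geq1$ positive singular values; these singular values are the Gram singular values of $A$ and $B$. *)

(* Defs.v *)
From HB Require Import structures.
From mathcomp Require Import all_boot all_order all_algebra.
Set Implicit Arguments. Unset Strict Implicit. Unset Printing Implicit Defensive.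
Import Order.TTheory GRing.Theory Num.Theory.
Local Open Scope ring_scope.

Section Defs.
Variable R : rcfType.

Definition is01 m n (M : 'M[R]_(m, n)) := forall i j, M i j = 0 \/ M i j = 1.

Definition is01m1 m n (M : 'M[R]_(m, n)) :=
  forall i j, M i j = 0 \/ M i j = 1 \/ M i j = -1.

Definition gram_mates m n (A B : 'M[R]_(m, n)) :=
  [/\ is01 A, is01 B, A != B, A *m A^T = B *m B^T & A^T *m A = B^T *m B].

Definition realizable m n (E : 'M[R]_(m, n)) :=
  [/\ is01m1 E, E *m (const_mx 1 : 'cV[R]_n) = 0, (const_mx 1 : 'rV[R]_m) *m E = 0
    & exists A, gram_mates A (A + E)].

Definition gram_mates_via m n (E A B : 'M[R]_(m, n)) :=
  gram_mates A B /\ (A - B = E \/ A - B = - E).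

(* SVD-based conversion witness: A = U Sig V^T is a singular value
   decomposition (U, V orthogonal, Sig rectangular diagonal with nonnegative
   entries), S is a nonempty set of indices i of positive singular values
   Sig i i, and B is obtained by changing the signs of those singular values.
   The Gram singular values are the Sig i i, i in S, and the corresponding
   left/right singular vectors are column i of U and column i of V. *)
Definition svd_conversion m n (A B : 'M[R]_(m, n)) (U : 'M[R]_m) (Sig : 'M[R]_(m, n))
  (V : 'M[R]_n) (S : {set 'I_m}) :=
  U^T *m U = 1%:M /\ V^T *m V = 1%:M /\
  (forall i j, val i != val j -> Sig i j = 0) /\ (forall i j, 0 <= Sig i j) /\
  A = U *m Sig *m V^T /\
  S != set0 /\ (forall i, i \in S -> exists j : 'I_n, val j = val i /\ 0 < Sig i j) /\
  B = U *m (\matrix_(i, j) (if i \in S then - Sig i j else Sig i j)) *m V^T.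

Definition convertible m n (A B : 'M[R]_(m, n)) :=
  exists U Sig V S, @svd_conversion m n A B U Sig V S.

Definition Emat k1 k2 p q : 'M[R]_(k1 + k1 + p, k2 + k2 + q) :=
  block_mx (block_mx (const_mx 1) (- const_mx 1) (- const_mx 1) (const_mx 1)) 0 0 0.

Definition Amat k1 k2 p q (X1 X2 : 'M[R]_(k1, q)) (X3 X4 : 'M[R]_(p, k2))
  (Y : 'M[R]_(p, q)) : 'M[R]_(k1 + k1 + p, k2 + k2 + q) :=
  block_mx (block_mx 0 (const_mx 1) (const_mx 1) 0) (col_mx X1 X2) (row_mx X3 X4) Y.

Definition uvec k1 p : 'cV[R]_(k1 + k1 + p) :=
  (Num.sqrt (2 * k1%:R))^-1 *: col_mx (col_mx (- const_mx 1) (const_mx 1)) 0.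
Definition vvec k2 q : 'cV[R]_(k2 + k2 + q) :=
  (Num.sqrt (2 * k2%:R))^-1 *: col_mx (col_mx (const_mx 1) (- const_mx 1)) 0.

End Defs.

(* Main.v *)
Require Import Defs.
From HB Require Import structures.
From mathcomp Require Import all_boot all_order all_algebra.
From mathcomp Require Import complex ring lra.
Import Order.TTheory GRing.Theory Num.Theory.
Set Implicit Arguments. Unset Strict Implicit. Unset Printing Implicit Defensive.
Local Open Scope ring_scope.

(** Writing [s = sqrt (k1 k2)], the matrix [E] equals [- 2 s u v^T] for the unit
vectors [u = uvec] and [v = vvec].  Expanding [(A + E)(A + E)^T] and
[(A + E)^T (A + E)] shows that [A] and [A + E] have the same Gram matrices iff
[A v = s u] and [A^T u = s v], i.e. iff [(s, u, v)] is a singular triple of [A];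
in block form these are the row- and column-sum conditions on the [X_i].  A
singular triple can be split off by Householder reflections and completed to a
singular value decomposition in which [E] flips the sign of [s], whence
convertibility.  Conversely, if flipping the signs of the singular values in
[S] subtracts [2 s u v^T], then in the singular bases a diagonal matrix has rank
one, so it has a single nonzero entry, and [u], [v] are the corresponding
singular vectors up to sign. *)

(** * Existence of singular value decompositions over a real closed field *)

Section SingularValueDecomposition.
Variable R : rcfType.

Definition sqnorm n (x : 'cV[R]_n) : R := (x^T *m x) 0 0.

Lemma sqnormE n (x : 'cV[R]_n) : sqnorm x = \sum_i x i 0 ^+ 2.
Proof. by rewrite /sqnorm mxE; apply: eq_bigr => i _; rewrite mxE expr2. Qed.

Lemma sqnorm_mx n (x : 'cV[R]_n) : x^T *m x = (sqnorm x)%:M.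
Proof. exact: mx11_scalar. Qed.

Lemma sqnorm_ge0 n (x : 'cV[R]_n) : 0 <= sqnorm x.
Proof. by rewrite sqnormE; apply: sumr_ge0 => i _; exact: sqr_ge0. Qed.

Lemma sqnorm_eq0 n (x : 'cV[R]_n) : (sqnorm x == 0) = (x == 0).
Proof.
apply/eqP/eqP => [|->]; last by rewrite /sqnorm mulmx0 mxE.
rewrite sqnormE => /eqP; rewrite psumr_eq0 => [/allP x0|i _]; last exact: sqr_ge0.
apply/colP => i; rewrite mxE; apply/eqP; rewrite -sqrf_eq0.
by apply: x0; rewrite mem_index_enum.
Qed.

Lemma normalize n (x : 'cV[R]_n) :
  x != 0 -> exists c, (c *: x)^T *m (c *: x) = 1%:M.
Proof.
rewrite -sqnorm_eq0 => x0; exists (Num.sqrt (sqnorm x))^-1.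
rewrite [(_ *: _)^T]linearZ /= -scalemxAl -scalemxAr scalerA -invfM -expr2 sqr_sqrtr ?sqnorm_ge0 //.
by rewrite sqnorm_mx scale_scalar_mx mulVf.
Qed.

(** As [R[i]] is algebraically closed, the characteristic polynomial has a complex root. Once that
    root is known to be real, the real and imaginary parts of its eigenvector satisfy the same
    eigenvalue equation, and at least one of them is nonzero. *)
Lemma sym_eigenvector n (M : 'M[R]_n.+1) : M^T = M ->
  exists a, exists2 x : 'cV[R]_n.+1, x^T *m x = 1%:M & M *m x = a *: x.
Proof.
move=> symM; pose f : {rmorphism R -> R[i]} := real_complex R.
have [|z] := @closed_rootP R[i] (char_poly (map_mx f M)) _.
  by rewrite size_char_poly.
rewrite -eigenvalue_root_char => /eigenvalueP[w wM w0].
pose x := map_mx (@complex.Re R) w; pose y := map_mx (@complex.Im R) w.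
pose a := complex.Re z; pose b := complex.Im z.
have wE : w = map_mx f x + 'i%C *: map_mx f y.
  by apply/rowP=> j; rewrite !mxE -complexE.
have : map_mx f (x *m M) + 'i%C *: map_mx f (y *m M) = z *: w.
  by rewrite !map_mxM scalemxAl -mulmxDl -wE.
have split_complex (s t : 'rV[R]_n.+1) :
    map_mx f s + 'i%C *: map_mx f t = z *: w ->
    s = a *: x - b *: y /\ t = a *: y + b *: x.
  move=> /rowP e; split; apply/rowP => j; move: (e j); rewrite !mxE /a /b.
    by case: (z) (w 0 j) => ? ? [? ?] /= [<- _]; ring.
  by case: (z) (w 0 j) => ? ? [? ?] /= [_ e2]; move: e2; lra.
move=> /split_complex[xM yM].
(* Symmetry of [M] forces the imaginary part [b] of the eigenvalue to vanish. *)
have b0 : b = 0.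
  have : x *m (y *m M)^T = x *m M *m y^T by rewrite trmx_mul symM mulmxA.
  rewrite yM xM [(_ + _)^T]linearD /= [(a *: _)^T]linearZ [(b *: _)^T]linearZ /=.
  rewrite mulmxDr mulmxBl -!scalemxAr -!scalemxAl.
  move/addrI/eqP; rewrite -subr_eq0 opprK -scalerDr => /eqP/matrixP/(_ 0 0).
  have rowE (t : 'rV[R]_n.+1) : t *m t^T = (sqnorm t^T)%:M.
    by rewrite -sqnorm_mx trmxK.
  rewrite !rowE 4!mxE !mulr1n [RHS]mxE.
  move/eqP; rewrite mulf_eq0 => /orP[/eqP//|].
  rewrite paddr_eq0 ?sqnorm_ge0 // !sqnorm_eq0 !trmx_eq0 => /andP[/eqP x0 /eqP y0].
  by case/eqP: w0; rewrite wE x0 y0 !map_mx0 scaler0 addr0.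
rewrite b0 !scale0r subr0 in xM; rewrite b0 !scale0r addr0 in yM.
have [s s0 sM] : exists2 s : 'rV[R]_n.+1, s != 0 & s *m M = a *: s.
  have [x0|] := eqVneq x 0; last by exists x.
  exists y => //; apply: contraNneq w0 => y0.
  by rewrite wE x0 y0 !map_mx0 scaler0 addr0.
have [c c1] : exists c, (c *: s^T)^T *m (c *: s^T) = 1%:M.
  by apply: normalize; rewrite trmx_eq0.
exists a, (c *: s^T) => //.
by rewrite -scalemxAr -{1}symM -trmx_mul sM linearZ scalerA mulrC -scalerA.
Qed.

Lemma orthogonal_transport n (e u : 'cV[R]_n) :
  e^T *m e = 1%:M -> u^T *m u = 1%:M ->
  exists2 Q : 'M[R]_n, Q^T *m Q = 1%:M & Q *m e = u.
Proof.
move=> e1 u1; have [<-|neu] := eqVneq e u.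
  by exists 1%:M; rewrite ?trmx1 mul1mx.
(* The Householder reflection exchanging [e] and [u]. *)
pose w := e - u; pose N := sqnorm w.
have N0 : N != 0 by rewrite sqnorm_eq0 subr_eq0.
have uTe : u^T *m e = e^T *m u by rewrite [LHS]mx11_scalar -tr_scalar_mx -mx11_scalar trmx_mul trmxK.
have we : w^T *m e = (N / 2)%:M.
  (* Since [e] and [u] are both unit vectors, the squared norm of [e - u] is 2 - 2 [u^T e], twice
     the inner product of [e - u] with [e]. *)
  have -> : w^T *m e = 2^-1 *: (w^T *m w).
    rewrite /w linearB /= !mulmxBl !mulmxBr e1 u1 uTe.
    by apply/matrixP => i j; rewrite !mxE; field.
  by rewrite sqnorm_mx scale_scalar_mx mulrC.
pose Q := 1%:M - (2 / N) *: (w *m w^T).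
have QT : Q^T = Q by rewrite linearB /= trmx1 linearZ /= trmx_mul trmxK.
exists Q.
  rewrite QT /Q mulmxBl mul1mx mulmxBr mulmx1 -!scalemxAl -!scalemxAr.
  rewrite mulmxA -(mulmxA w) sqnorm_mx mul_mx_scalar -/N -scalemxAl !scalerA.
  by move: (w *m w^T) => W; apply/matrixP => i j; rewrite !mxE; field.
rewrite /Q mulmxBl mul1mx -scalemxAl -mulmxA we mul_mx_scalar scalerA.
have -> : 2 / N * (N / 2) = 1 by field.
by rewrite scale1r /w opprB addrC subrK.
Qed.

Definition is_svd m n (A : 'M[R]_(m, n)) (U : 'M[R]_m) (Sig : 'M[R]_(m, n))
    (V : 'M[R]_n) :=
  [/\ U^T *m U = 1%:M, V^T *m V = 1%:M,
      forall i j, val i != val j -> Sig i j = 0,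
      forall i j, 0 <= Sig i j & A = U *m Sig *m V^T].

Definition singular_pair m n (A : 'M[R]_(m, n)) s (u : 'cV[R]_m) (v : 'cV[R]_n) :=
  [/\ u^T *m u = 1%:M, v^T *m v = 1%:M, A *m v = s *: u & A^T *m u = s *: v].

Lemma singular_pair_tr m n (A : 'M[R]_(m, n)) s u v :
  singular_pair A s u v -> singular_pair A^T s v u.
Proof. by case=> u1 v1 Av Au; split; rewrite ?trmxK. Qed.

(** A unit eigenvector [u] of [A A^T] has eigenvalue [a], the squared norm of [A^T u]. If [a] is
    positive, normalizing [A^T u] gives [v]. If [a] is zero, [u] lies in the left kernel, so the
    rank of [A] is below the number of rows, hence below the number of columns, and a unit [v] in
    the right kernel completes a pair with value 0. *)
Lemma exists_singular_pair_wide m n (A : 'M[R]_(m.+1, n.+1)) : (m <= n)%N ->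
  exists s u v, 0 <= s /\ singular_pair A s u v.
Proof.
move=> le_mn.
have [|a [u u1 Au]] := @sym_eigenvector m (A *m A^T).
  by rewrite trmx_mul trmxK.
have aE : a = sqnorm (A^T *m u).
  rewrite /sqnorm trmx_mul trmxK -mulmxA (mulmxA A) Au -scalemxAr u1.
  by rewrite !mxE mulr1.
have [a0|a0] := eqVneq a 0.
  have Au0 : A^T *m u = 0 by apply/eqP; rewrite -sqnorm_eq0 -aE a0.
  have rankA : (\rank A < n.+1)%N.
    apply: leq_trans (_ : m.+1 <= n.+1)%N => //.
    rewrite ltn_neqAle rank_leq_row andbT.
    apply/negP => /(row_free_inj (m:=1)) /(_ u^T 0).
    rewrite mul0mx -[A]trmxK -trmx_mul Au0 trmx0 => /(_ erefl) /eqP.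
    rewrite trmx_eq0 => /eqP u0; move: u1; rewrite u0 mulmx0 => /matrixP /(_ 0 0) /eqP.
    by rewrite !mxE eq_sym oner_eq0.
  have /rowV0Pn[v /sub_kermxP vA v0] : kermx A^T != 0.
    by rewrite kermx_eq0 /row_free mxrank_tr neq_ltn rankA.
  have [|c c1] := @normalize _ v^T; first by rewrite trmx_eq0.
  exists 0, u, (c *: v^T); split=> //; split=> //.
    by rewrite -scalemxAr -[A]trmxK -trmx_mul vA trmx0 scaler0 scale0r.
  by rewrite Au0 scale0r.
have a_gt0 : 0 < a by rewrite lt_neqAle eq_sym a0 aE sqnorm_ge0.
have s0 : Num.sqrt a != 0 by rewrite sqrtr_eq0 -ltNge.
exists (Num.sqrt a), u, ((Num.sqrt a)^-1 *: (A^T *m u)).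
have sE : a = Num.sqrt a * Num.sqrt a by rewrite -expr2 sqr_sqrtr ?ltW.
split; first exact: sqrtr_ge0.
split=> //.
- rewrite [(_ *: _)^T]linearZ /= -scalemxAl -scalemxAr sqnorm_mx -aE scalerA scale_scalar_mx.
  by rewrite {3}sE -invfM mulVf // mulf_neq0.
- by rewrite -scalemxAr mulmxA Au scalerA {2}sE mulrA mulVf // mul1r.
- by rewrite scalerA mulfV // scale1r.
Qed.

Lemma exists_singular_pair m n (A : 'M[R]_(m.+1, n.+1)) :
  exists s u v, 0 <= s /\ singular_pair A s u v.
Proof.
case/orP: (leq_total m n) => [|le_nm]; first exact: exists_singular_pair_wide.
have [s [u [v [s0 /singular_pair_tr]]]] := exists_singular_pair_wide A^T le_nm.
by rewrite trmxK => Avu; exists s, v, u.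
Qed.

(** Take orthogonal [P] and [Q] carrying the first basis vectors to [u] and [v]. In these bases
    [A v = s u] fixes the first column of [A], and [A^T u = s v] fixes its first row. *)
Lemma singular_pair_deflate m n (A : 'M[R]_(1 + m, 1 + n)) s u v :
  singular_pair A s u v ->
  exists P Q (A' : 'M[R]_(m, n)),
    [/\ P^T *m P = 1%:M, Q^T *m Q = 1%:M, P *m col_mx 1%:M 0 = u,
        Q *m col_mx 1%:M 0 = v & A = P *m block_mx s%:M 0 0 A' *m Q^T].
Proof.
have unit_e k : (col_mx 1%:M 0 : 'cV[R]_(1 + k))^T *m col_mx 1%:M 0 = 1%:M.
  by rewrite tr_col_mx mul_row_col trmx1 mulmx1 mulmx0 addr0.
case=> u1 v1 Av Au.
have [P P1 Pu] := orthogonal_transport (unit_e m) u1.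
have [Q Q1 Qv] := orthogonal_transport (unit_e n) v1.
pose C : 'M[R]_(1 + m, 1 + n) := P^T *m A *m Q.
have Ce : C *m col_mx 1%:M 0 = s *: col_mx 1%:M 0.
  by rewrite /C -mulmxA Qv -mulmxA Av -scalemxAr -Pu mulmxA P1 mul1mx.
have eC : C^T *m col_mx 1%:M 0 = s *: col_mx 1%:M 0.
  by rewrite /C !trmx_mul trmxK -!mulmxA Pu Au -scalemxAr -Qv mulmxA Q1 mul1mx.
exists P, Q, (drsubmx C); split=> //.
have <- : C = block_mx s%:M 0 0 (drsubmx C).
  rewrite -[C]submxK in Ce eC *.
  move: Ce eC; rewrite tr_block_mx !mul_block_col !mulmx0 !addr0 !mulmx1.
  rewrite !scale_col_mx !scaler0 => /eq_col_mx[-> ->] /eq_col_mx[_ /(canRL trmxK) ->].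
  by rewrite trmx0 scalemx1 block_mxKdr.
by rewrite /C !mulmxA (mulmx1C P1) mul1mx -mulmxA (mulmx1C Q1) mulmx1.
Qed.

Lemma orthogonal_block m (P : 'M[R]_(1 + m)) (U : 'M[R]_m) :
  P^T *m P = 1%:M -> U^T *m U = 1%:M ->
  (P *m block_mx 1%:M 0 0 U)^T *m (P *m block_mx 1%:M 0 0 U) = 1%:M.
Proof.
move=> P1 U1; rewrite trmx_mul -mulmxA (mulmxA P^T) P1 mul1mx.
rewrite tr_block_mx mulmx_block !trmx0 !mulmx0 !mul0mx trmx1 mulmx1 U1 !addr0 add0r.
by rewrite -scalar_mx_block.
Qed.

(** The corner [t] is arbitrary so that the same factorization serves with [s], for the
    decomposition, and with [- s], after the sign change. *)
Lemma block_svd m n (P : 'M[R]_(1 + m)) (Q : 'M[R]_(1 + n))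
    (A' Sig : 'M[R]_(m, n)) (U : 'M[R]_m) (V : 'M[R]_n) t :
  A' = U *m Sig *m V^T ->
  P *m block_mx t%:M 0 0 A' *m Q^T =
  P *m block_mx 1%:M 0 0 U *m block_mx t%:M 0 0 Sig *m (Q *m block_mx 1%:M 0 0 V)^T.
Proof.
move=> ->; rewrite trmx_mul !mulmxA; congr (_ *m _); rewrite -!mulmxA; congr (_ *m _).
rewrite tr_block_mx !mulmx_block !trmx0 trmx1.
by rewrite !(mulmx0, mul0mx, mul1mx, mulmx1, addr0, add0r).
Qed.

Lemma is_svd_deflate m n (A : 'M[R]_(1 + m, 1 + n)) P Q (A' : 'M[R]_(m, n)) s U Sig V :
  P^T *m P = 1%:M -> Q^T *m Q = 1%:M -> 0 <= s ->
  A = P *m block_mx s%:M 0 0 A' *m Q^T -> is_svd A' U Sig V ->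
  is_svd A (P *m block_mx 1%:M 0 0 U) (block_mx s%:M 0 0 Sig)
    (Q *m block_mx 1%:M 0 0 V).
Proof.
move=> P1 Q1 s0 AE [U1 V1 Sd S0 A'E].
split; [exact: orthogonal_block|exact: orthogonal_block| | |].
- move=> i j; case: (split_ordP i) => i' ->; case: (split_ordP j) => j' -> /=.
  + by rewrite !ord1 eqxx.
  + by rewrite block_mxEur mxE.
  + by rewrite block_mxEdl mxE.
  + by rewrite block_mxEdr eqn_add2l => /Sd.
- move=> i j; case: (split_ordP i) => i' ->; case: (split_ordP j) => j' -> /=.
  + by rewrite block_mxEul mxE !ord1 mulr1n.
  + by rewrite block_mxEur mxE.
  + by rewrite block_mxEdl mxE.
  + by rewrite block_mxEdr.
- by rewrite AE; apply: block_svd.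
Qed.

(** Induction on the number of rows: a singular pair is split off and the remaining block is
    decomposed. An empty matrix is its own diagonal factor. *)
Lemma exists_svd m n (A : 'M[R]_(m, n)) : exists U Sig V, is_svd A U Sig V.
Proof.
elim: m n A => [|m IH] [|n] A.
1-3: exists 1%:M, A, 1%:M; split; rewrite ?trmx1 ?mul1mx ?mulmx1 //.
1-6: by move=> i j; have := ltn_ord i; have := ltn_ord j.
have [s [u [v [s0 /(@singular_pair_deflate m n)]]]] := exists_singular_pair A.
move=> [P [Q [A' [P1 Q1 _ _ AE]]]].
have [U [Sig [V svdA']]] := IH _ A'.
by do 3!eexists; exact: (is_svd_deflate P1 Q1 s0 AE svdA').
Qed.

(** In the deflated bases [u v^T] is the matrix unit of the upper-left corner, so the subtraction
    turns [s] into [- s] there and leaves the block [A'] alone. The flipped index is 0. *)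
Lemma singular_pair_convertibleS m n (A : 'M[R]_(1 + m, 1 + n)) s u v :
  0 < s -> singular_pair A s u v -> convertible A (A - (2 * s) *: (u *m v^T)).
Proof.
move=> s0 Auv.
have [P [Q [A' [P1 Q1 Pu Qv AE]]]] := singular_pair_deflate Auv.
have [U [Sig [V svdA']]] := exists_svd A'.
have [U1 V1 Sd S0 AE'] := is_svd_deflate P1 Q1 (ltW s0) AE svdA'.
exists (P *m block_mx 1%:M 0 0 U), (block_mx s%:M 0 0 Sig).
exists (Q *m block_mx 1%:M 0 0 V), [set lshift m 0].
do 5!split=> //; split; first by apply/set0Pn; exists (lshift m 0); rewrite set11.
split=> [i|].
  rewrite inE => /eqP ->; exists (lshift n 0); split=> //.
  by rewrite block_mxEul mxE.
have uv : u *m v^T = P *m block_mx 1%:M 0 0 0 *m Q^T.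
  rewrite -Pu -Qv trmx_mul mulmxA -(mulmxA P) tr_col_mx mul_col_row trmx1 trmx0.
  by rewrite !(mulmx1, mulmx0, mul0mx).
have -> : A - (2 * s) *: (u *m v^T) = P *m block_mx (- s)%:M 0 0 A' *m Q^T.
  rewrite {1}AE uv scalemxAl scalemxAr -mulmxBl -mulmxBr.
  rewrite scale_block_mx opp_block_mx add_block_mx !scaler0 !subr0.
  by rewrite scalemx1 -raddfB /=; congr (_ *m block_mx _%:M _ _ _ *m _); ring.
case: svdA' => _ _ _ _ A'E; rewrite (block_svd _ _ _ A'E); congr (_ *m _ *m _).
apply/matrixP => i j; rewrite [RHS]mxE inE.
case: (split_ordP i) => i' ->; case: (split_ordP j) => j' ->.
- by rewrite ord1 !block_mxEul eqxx !mxE mulNrn.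
- by rewrite ord1 !block_mxEur eqxx !mxE oppr0.
- by rewrite !block_mxEdl eq_rlshift !mxE.
- by rewrite !block_mxEdr eq_rlshift.
Qed.

Lemma singular_pair_convertible m n (A : 'M[R]_(m, n)) s u v :
  0 < s -> singular_pair A s u v -> convertible A (A - (2 * s) *: (u *m v^T)).
Proof.
(* Dimension 0 has no unit vector, so a singular pair forces both dimensions to be positive. *)
have unit0 (x : 'cV[R]_0) : x^T *m x <> 1%:M.
  by rewrite [x]flatmx0 mulmx0 => /matrixP/(_ 0 0)/eqP; rewrite !mxE eq_sym oner_eq0.
case: m n A u v => [|m] [|n] A u v s0; last exact: (@singular_pair_convertibleS m n).
- by case=> /unit0.
- by case=> /unit0.
- by case=> _ /unit0.
Qed.

End SingularValueDecomposition.

(** * Rank-one perturbations, Gram matrices and singular vectors *)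

Section RankOnePerturbation.
Variables (R : rcfType) (m n : nat).
Implicit Types (A B : 'M[R]_(m, n)) (u : 'cV[R]_m) (v : 'cV[R]_n) (s : R).

Lemma outer_product_entry u v i j : (u *m v^T) i j = u i 0 * v j 0.
Proof. by rewrite mxE big_ord1 mxE. Qed.

Lemma gram_rank1 A u v s : s != 0 -> u^T *m u = 1%:M -> v^T *m v = 1%:M ->
  let B := A - (2 * s) *: (u *m v^T) in
  A *m A^T = B *m B^T <-> A *m v = s *: u.
Proof.
move=> s0 u1 v1 B; set w := A *m v.
have BB : A *m A^T - B *m B^T =
    (2 * s) *: (w *m u^T + u *m w^T - (2 * s) *: (u *m u^T)).
  have uA : u *m v^T *m A^T = u *m w^T by rewrite -mulmxA -trmx_mul.
  have Au : A *m (v *m u^T) = w *m u^T by rewrite mulmxA.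
  have uu : u *m v^T *m (v *m u^T) = u *m u^T.
    by rewrite -mulmxA (mulmxA v^T) v1 mul1mx.
  have -> : B^T = A^T - (2 * s) *: (v *m u^T).
    by rewrite /B linearB /= [(_ *: _)^T]linearZ /= trmx_mul trmxK.
  rewrite /B mulmxBl !mulmxBr -!scalemxAl -!scalemxAr uA Au uu.
  move: (A *m A^T) (w *m u^T) (u *m w^T) (u *m u^T) => M1 M2 M3 M4.
  by apply/matrixP => i j; rewrite !mxE; ring.
clearbody w; split=> [/eqP|wE].
  rewrite -subr_eq0 BB scaler_eq0 mulf_eq0 pnatr_eq0 (negPf s0) /= => /eqP K.
  (* Multiplying by [u] gives [w = (2s - c) u] with [c = w^T u]; pairing this with [u] gives
     [c = 2s - c], so [c = s]. *)
  have := congr1 (mulmx^~ u) K; rewrite /= mul0mx mulmxBl mulmxDl -scalemxAl.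
  rewrite -!mulmxA u1 !mulmx1 [w^T *m u]mx11_scalar mul_mx_scalar.
  set c := (w^T *m u) 0 0 => /eqP.
  rewrite -addrA -scalerBl addr_eq0 -scaleNr opprB => /eqP wE.
  have : c = 2 * s - c.
    by rewrite {1}/c {1}wE [(_ *: _)^T]linearZ /= -scalemxAl u1 !mxE mulr1.
  by rewrite wE => ce; congr (_ *: _); lra.
apply/eqP; rewrite -subr_eq0 BB wE [(_ *: _)^T]linearZ /=.
rewrite -scalemxAl -scalemxAr -scalerDl -scalerBl.
by rewrite (_ : s + s - 2 * s = 0) ?scale0r ?scaler0 //; ring.
Qed.

Lemma svd_conversion_rank1 A B U Sig V S u v s :
  0 < s -> u^T *m u = 1%:M -> v^T *m v = 1%:M ->
  A - B = (2 * s) *: (u *m v^T) -> svd_conversion A B U Sig V S ->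
  exists i, S = [set i] /\ exists j : 'I_n, val j = val i /\ Sig i j = s /\
    (col i U = u \/ col i U = - u) /\ (col j V = v \/ col j V = - v).
Proof.
move=> s0 u1 v1 AB [U1 [V1 [Sd [_ [AE [S0 [Sp BE]]]]]]].
pose x := U^T *m u; pose y := V^T *m v.
(* This is [U^T (A - B) V] read entrywise: a flipped entry contributes twice its value and all
   others cancel. *)
have DE i j : (if i \in S then Sig i j else 0) = s * (x i 0 * y j 0).
  have : U^T *m (A - B) *m V = (2 * s) *: (x *m y^T).
    by rewrite AB -scalemxAr -scalemxAl /x /y trmx_mul trmxK !mulmxA.
  rewrite AE BE -mulmxBl -mulmxBr !mulmxA U1 mul1mx -mulmxA V1 mulmx1.
  move/matrixP/(_ i j); rewrite [RHS]mxE outer_product_entry !mxE.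
  by case: ifP => _ e; lra.
have xx : x^T *m x = 1%:M.
  by rewrite /x trmx_mul trmxK mulmxA -(mulmxA u^T) (mulmx1C U1) mulmx1.
have yy : y^T *m y = 1%:M.
  by rewrite /y trmx_mul trmxK mulmxA -(mulmxA v^T) (mulmx1C V1) mulmx1.
have uE : u = U *m x by rewrite mulmxA (mulmx1C U1) mul1mx.
have vE : v = V *m y by rewrite mulmxA (mulmx1C V1) mul1mx.
have [i iS] := set0Pn _ S0; have [j [ji Sij]] := Sp i iS.
have xy0 : 0 < x i 0 * y j 0.
  by have := DE i j; rewrite iS => e; rewrite -(pmulr_rgt0 _ s0) -e.
have /norP[x0 y0] : ~~ ((x i 0 == 0) || (y j 0 == 0)) by rewrite -mulf_eq0 gt_eqF.
(* Row [i] and column [j] of the diagonal matrix vanish off their common entry; as [x i 0] and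
   [y j 0] are nonzero, the other coordinates of [y] and [x] vanish. *)
have y_off j' : j' != j -> y j' 0 = 0.
  move=> nj; have := DE i j'; rewrite iS Sd.
    by move/esym/eqP; rewrite !mulf_eq0 gt_eqF // (negPf x0) => /eqP.
  by rewrite -ji eq_sym.
have x_off i' : i' != i -> x i' 0 = 0.
  move=> ni; have := DE i' j; rewrite Sd; last by rewrite ji.
  rewrite if_same => /esym/eqP.
  by rewrite !mulf_eq0 gt_eqF // (negPf y0) orbF => /eqP.
(* A unit vector supported on one coordinate is a basis vector up to sign, so its image under [W] is
   a column up to sign. *)
have unit_delta k (W : 'M[R]_k) (z : 'cV[R]_k) l : z^T *m z = 1%:M ->
    (forall l', l' != l -> z l' 0 = 0) ->
    (z l 0 = 1 /\ W *m z = col l W) \/ (z l 0 = -1 /\ W *m z = - col l W).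
  move=> zz z_off.
  have zE : z = z l 0 *: delta_mx l 0.
    apply/colP => l'; rewrite !mxE andbT.
    by have [->|/z_off ->] := eqVneq l' l; rewrite ?mulr1 ?mulr0.
  have : z l 0 ^+ 2 == 1.
    have := congr1 (fun M : 'M[R]_1 => M 0 0) zz.
    rewrite -[LHS]/(sqnorm z) sqnormE (bigD1 l) //= big1 ?addr0 => [->|l' /z_off ->].
      by rewrite mxE.
    by rewrite expr0n.
  rewrite sqrf_eq1 => /orP[]/eqP zl; [left|right]; split=> //.
    by rewrite zE zl scale1r -colE.
  by rewrite zE zl scaleN1r mulmxN -colE.
exists i; split.
  apply/setP => i'; rewrite inE; apply/idP/eqP => [i'S|-> //].
  have [j' [j'i' Sij']] := Sp i' i'S.
  apply/eqP; apply: contraTT Sij' => ni.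
  by have := DE i' j'; rewrite i'S x_off // mul0r mulr0 => ->; rewrite ltxx.
exists j; split=> //.
have := DE i j; rewrite iS => ->.
(* Of the four sign patterns, the two mixed ones contradict the positivity of [x i 0 * y j 0]. *)
case: (unit_delta _ U x i xx x_off) => -[xi]; rewrite -uE => eu;
  case: (unit_delta _ V y j yy y_off) => -[yj]; rewrite -vE => ev;
  move: xy0; rewrite xi yj eu ev ?mulrNN ?mulrN ?mulNr ?mulr1 ?opprK;
  rewrite ?ltr0N1 => xy0; first by do !split; left.
1-2: by exfalso; move: xy0; lra.
by do !split; right.
Qed.

End RankOnePerturbation.

(** The second Gram identity is the first one for [A^T], with [u] and [v] exchanged. *)
Lemma gram_rank1_singular_pair (R : rcfType) m n (A : 'M[R]_(m, n)) u v s :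
  s != 0 -> u^T *m u = 1%:M -> v^T *m v = 1%:M ->
  let B := A - (2 * s) *: (u *m v^T) in
  (A *m A^T = B *m B^T /\ A^T *m A = B^T *m B) <-> singular_pair A s u v.
Proof.
move=> s0 u1 v1 B.
have BT : A^T - (2 * s) *: (v *m u^T) = B^T.
  by rewrite /B linearB /= [(_ *: _)^T]linearZ /= trmx_mul trmxK.
have := gram_rank1 A^T s0 v1 u1; have := gram_rank1 A s0 u1 v1.
rewrite /= BT !trmxK -/B => Av Au.
by split=> [[/Av ? /Au ?]|[_ _ /Av ? /Au ?]].
Qed.

(** * The matrix [E] as a multiple of an outer product of unit vectors *)

Section RankOneGramMates.
Variables (R : rcfType) (k1 k2 p q : nat).
Hypotheses (hk1 : (0 < k1)%N) (hk2 : (0 < k2)%N).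

Let sigma : R := Num.sqrt (k1%:R * k2%:R).

Lemma vvecE k r : vvec R k r = - uvec R k r.
Proof. by rewrite /vvec /uvec -scalerN !opp_col_mx opprK oppr0. Qed.

Lemma const_mx1_mul a b :
  (const_mx 1 : 'M[R]_(a, b)) *m (const_mx 1 : 'cV_b) = const_mx b%:R.
Proof.
apply/matrixP => i j; rewrite !mxE (eq_bigr (fun=> 1)) => [|l _].
  by rewrite sumr_const card_ord.
by rewrite !mxE mulr1.
Qed.

Lemma uvec_unit k r : (0 < k)%N -> (uvec R k r)^T *m uvec R k r = 1%:M.
Proof.
move=> k0; have K0 : 0 < 2 * k%:R :> R by rewrite mulr_gt0 ?ltr0n.
rewrite /uvec [(_ *: _)^T]linearZ /= -scalemxAl -scalemxAr scalerA -invfM -expr2.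
rewrite sqr_sqrtr ?ltW // !tr_col_mx !mul_row_col trmx0 mulmx0 addr0.
rewrite [(- _)^T]linearN /= mulNmx mulmxN opprK.
have -> : (const_mx 1 : 'cV[R]_k)^T *m const_mx 1 = k%:R%:M.
  by rewrite trmx_const const_mx1_mul [LHS]mx11_scalar mxE.
have -> : k%:R%:M + k%:R%:M = (2 * k%:R)%:M :> 'M[R]_1.
  by rewrite -raddfD /=; congr _%:M; ring.
by rewrite scale_scalar_mx mulVf // gt_eqF.
Qed.

Lemma vvec_unit k r : (0 < k)%N -> (vvec R k r)^T *m vvec R k r = 1%:M.
Proof. by move=> k0; rewrite vvecE [(- _)^T]linearN /= mulNmx mulmxN opprK uvec_unit. Qed.

Lemma sqrt_nat_neq0 k : (0 < k)%N -> Num.sqrt (k%:R : R) != 0.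
Proof. by move=> k0; rewrite sqrtr_eq0 -ltNge ltr0n. Qed.

Lemma sqrt_natK k : Num.sqrt (k%:R : R) * Num.sqrt k%:R = k%:R.
Proof. by rewrite -expr2 sqr_sqrtr ?ler0n. Qed.

Lemma sigma_gt0 : 0 < sigma.
Proof. by rewrite sqrtr_gt0 mulr_gt0 ?ltr0n. Qed.

Lemma EmatE :
  Emat R k1 k2 p q = - ((2 * sigma) *: (uvec R k1 p *m (vvec R k2 q)^T)).
Proof.
rewrite /uvec /vvec [(_ *: _)^T]linearZ /= -scalemxAl -scalemxAr !scalerA.
have -> : 2 * sigma * (Num.sqrt (2 * k1%:R))^-1 / Num.sqrt (2 * k2%:R) = 1.
  (* Writing 2 as a product of two square roots lets every factor cancel. *)
  rewrite /sigma !sqrtrM ?ler0n // -[X in X * _ * _ / _](sqrt_natK 2).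
  by field; rewrite !sqrt_nat_neq0.
rewrite scale1r !tr_col_mx ![(- _)^T]linearN /= trmx0 !mul_col_row !(mulmx0, mul0mx).
rewrite !mulNmx !mulmxN !opprK.
have -> : (const_mx 1 : 'cV[R]_k1) *m (const_mx 1 : 'cV[R]_k2)^T = const_mx 1.
  by apply/matrixP => i j; rewrite outer_product_entry !mxE mulr1.
by rewrite !opp_block_mx !oppr0 opprK.
Qed.

(** The sign ambiguity in [A - B] is absorbed into the sign of [v], so both cases become one
    rank-one perturbation. *)
Lemma gram_mates_viaP A B : gram_mates_via (Emat R k1 k2 p q) A B ->
  exists v, [/\ v = vvec R k2 q \/ v = - vvec R k2 q,
    A - B = (2 * sigma) *: (uvec R k1 p *m v^T)
    & singular_pair A sigma (uvec R k1 p) v].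
Proof.
case=> -[_ _ _ AAT ATA] AB.
have [v vE ABE] : exists2 v, v = vvec R k2 q \/ v = - vvec R k2 q &
    A - B = (2 * sigma) *: (uvec R k1 p *m v^T).
  case: AB => ->; [exists (- vvec R k2 q)|exists (vvec R k2 q)]; auto; rewrite EmatE.
  - by rewrite [(- _)^T]linearN /= mulmxN scalerN.
  - by rewrite opprK.
exists v; split=> //; apply/gram_rank1_singular_pair.
- by rewrite gt_eqF ?sigma_gt0.
- exact: uvec_unit.
- by case: vE => ->; rewrite ?[(- _)^T]linearN /= ?mulNmx ?mulmxN ?opprK vvec_unit.
- by rewrite -ABE subKr.
Qed.

End RankOneGramMates.

(** * The block matrix [A]: its transpose and its action on [vvec] *)

Lemma tr_Amat (R : rcfType) k1 k2 p q (X1 X2 : 'M[R]_(k1, q)) (X3 X4 : 'M[R]_(p, k2)) Y :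
  (Amat X1 X2 X3 X4 Y)^T = Amat X3^T X4^T X1^T X2^T Y^T.
Proof. by rewrite /Amat !tr_block_mx tr_col_mx tr_row_mx !trmx0 !trmx_const. Qed.

(** The all-ones blocks make the upper block rows agree automatically; only the last block row,
    where [X3] and [X4] meet opposite signs, imposes a condition. *)
Lemma Amat_vvec (R : rcfType) k1 k2 p q (X1 X2 : 'M[R]_(k1, q)) (X3 X4 : 'M[R]_(p, k2)) Y :
  (0 < k1)%N -> (0 < k2)%N ->
  Amat X1 X2 X3 X4 Y *m vvec R k2 q = Num.sqrt (k1%:R * k2%:R) *: uvec R k1 p <->
  X3 *m (const_mx 1 : 'cV_k2) = X4 *m (const_mx 1 : 'cV_k2).
Proof.
move=> hk1 hk2.
have c0 : (Num.sqrt (2 * k2%:R))^-1 != 0 :> R.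
  by rewrite invr_eq0 sqrtr_eq0 -ltNge mulr_gt0 ?ltr0n.
have -> : Num.sqrt (k1%:R * k2%:R) *: uvec R k1 p = (Num.sqrt (2 * k2%:R))^-1 *:
    col_mx (col_mx (- const_mx k2%:R) (const_mx k2%:R)) 0.
  rewrite /uvec scalerA !scale_col_mx !scaler0 !scalerN !scalemx_const !mulr1.
  suff -> : Num.sqrt (k1%:R * k2%:R) / Num.sqrt (2 * k1%:R) =
      (Num.sqrt (2 * k2%:R))^-1 * k2%:R :> R by [].
  rewrite !sqrtrM ?ler0n // -[X in _ = _ * X]sqrt_natK.
  by field; rewrite !sqrt_nat_neq0.
rewrite /vvec -scalemxAr /Amat !mul_block_col mul_row_col.
rewrite !(mulmx0, mul0mx, addr0, add0r) !mulmxN !const_mx1_mul.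
split=> [/(scalerI c0)/eq_col_mx[_ /subr0_eq//]|->].
by rewrite subrr.
Qed.

(** * Entry conditions on block matrices *)

Lemma block_mx_forall (T : Type) (P : T -> Prop) m1 m2 n1 n2 (Aul : 'M[T]_(m1, n1))
    (Aur : 'M[T]_(m1, n2)) (Adl : 'M[T]_(m2, n1)) (Adr : 'M[T]_(m2, n2)) :
  (forall i j, P (block_mx Aul Aur Adl Adr i j)) <->
  [/\ forall i j, P (Aul i j), forall i j, P (Aur i j),
      forall i j, P (Adl i j) & forall i j, P (Adr i j)].
Proof.
split=> [PA|[Pul Pur Pdl Pdr] i j].
  by split=> i j; [have := PA (lshift _ i) (lshift _ j)|have := PA (lshift _ i) (rshift _ j)
    |have := PA (rshift _ i) (lshift _ j)|have := PA (rshift _ i) (rshift _ j)];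
    rewrite ?(block_mxEul, block_mxEur, block_mxEdl, block_mxEdr).
case: (split_ordP i) => i' ->; case: (split_ordP j) => j' ->;
  by rewrite ?(block_mxEul, block_mxEur, block_mxEdl, block_mxEdr).
Qed.

Lemma is01_block (R : rcfType) m1 m2 n1 n2 (Aul : 'M[R]_(m1, n1))
    (Aur : 'M[R]_(m1, n2)) (Adl : 'M[R]_(m2, n1)) (Adr : 'M[R]_(m2, n2)) :
  is01 (block_mx Aul Aur Adl Adr) <-> [/\ is01 Aul, is01 Aur, is01 Adl & is01 Adr].
Proof. exact: (block_mx_forall (fun x => x = 0 \/ x = 1)). Qed.

Lemma is01m1_block (R : rcfType) m1 m2 n1 n2 (Aul : 'M[R]_(m1, n1))
    (Aur : 'M[R]_(m1, n2)) (Adl : 'M[R]_(m2, n1)) (Adr : 'M[R]_(m2, n2)) :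
  is01m1 (block_mx Aul Aur Adl Adr) <->
  [/\ is01m1 Aul, is01m1 Aur, is01m1 Adl & is01m1 Adr].
Proof. exact: (block_mx_forall (fun x => x = 0 \/ x = 1 \/ x = -1)). Qed.

(** Adding [E] interchanges the zero and all-ones blocks in the upper-left part and changes nothing
    else. *)
Lemma is01_AmatDE (R : rcfType) k1 k2 p q (X1 X2 : 'M[R]_(k1, q)) (X3 X4 : 'M[R]_(p, k2)) Y :
  is01 (Amat X1 X2 X3 X4 Y) -> is01 (Amat X1 X2 X3 X4 Y + Emat R k1 k2 p q).
Proof.
rewrite /Amat /Emat => /is01_block[_ X12 X34 Y01].
rewrite !add_block_mx !addr0 !add0r subrr.
apply/is01_block; split=> //; apply/is01_block.
by split=> i j; rewrite mxE; auto.
Qed.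

(** * Gram mates via [E]: characterization, existence and conversion *)

Theorem theorem4p7 (R : rcfType) (k1 k2 p q : nat) (hk1 : (0 < k1)%N) (hk2 : (0 < k2)%N) :
  let E := Emat R k1 k2 p q in
  (* 1. *)
  (forall (X1 X2 : 'M[R]_(k1, q)) (X3 X4 : 'M[R]_(p, k2)) (Y : 'M[R]_(p, q)),
     is01 (Amat X1 X2 X3 X4 Y) ->
     (gram_mates (Amat X1 X2 X3 X4 Y) (Amat X1 X2 X3 X4 Y + E) <->
      ((const_mx 1 : 'rV[R]_k1) *m X1 = (const_mx 1 : 'rV[R]_k1) *m X2 /\
       X3 *m (const_mx 1 : 'cV[R]_k2) = X4 *m (const_mx 1 : 'cV[R]_k2)))) /\
  (* 2. *)
  realizable E /\
  (* 3. *)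
  (forall A B, gram_mates_via E A B -> convertible A B /\ convertible B A) /\
  (* 4. *)
  (forall A B, gram_mates_via E A B ->
     forall U Sig V S, svd_conversion A B U Sig V S ->
       exists i, S = [set i] /\
         exists j : 'I_(k2 + k2 + q), val j = val i /\
           Sig i j = Num.sqrt (k1%:R * k2%:R) /\
           (col i U = uvec R k1 p \/ col i U = - uvec R k1 p) /\
           (col j V = vvec R k2 q \/ col j V = - vvec R k2 q)).
Proof.
move=> E; set s := Num.sqrt (k1%:R * k2%:R).
have s0 : 0 < s := sigma_gt0 R hk1 hk2.
have u1 := uvec_unit R p hk1; have v1 := vvec_unit R q hk2.
have EE : E = - ((2 * s) *: (uvec R k1 p *m (vvec R k2 q)^T)) := EmatE R p q hk1 hk2.
have E0 : E != 0.
  apply/eqP => /matrixP /(_ (lshift p (lshift k1 (Ordinal hk1)))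
    (lshift q (lshift k2 (Ordinal hk2)))).
  by rewrite /E /Emat !block_mxEul !mxE => /eqP; rewrite oner_eq0.
have part1 (X1 X2 : 'M[R]_(k1, q)) (X3 X4 : 'M[R]_(p, k2)) (Y : 'M[R]_(p, q)) :
     is01 (Amat X1 X2 X3 X4 Y) ->
     (gram_mates (Amat X1 X2 X3 X4 Y) (Amat X1 X2 X3 X4 Y + E) <->
      ((const_mx 1 : 'rV[R]_k1) *m X1 = (const_mx 1 : 'rV[R]_k1) *m X2 /\
       X3 *m (const_mx 1 : 'cV[R]_k2) = X4 *m (const_mx 1 : 'cV[R]_k2))).
  move=> A01; have AE01 := is01_AmatDE A01; rewrite -/E in AE01.
  have AnE : Amat X1 X2 X3 X4 Y != Amat X1 X2 X3 X4 Y + E.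
    by rewrite -subr_eq0 opprD addNKr oppr_eq0.
  have Av := Amat_vvec X1 X2 X3 X4 Y hk1 hk2; rewrite -/s in Av.
  (* [A^T] has the same block shape with the roles of the [X] blocks exchanged, so column sums
     reduce to row sums. The exchange negates both singular vectors, which does not affect the
     equation. *)
  have Au := Amat_vvec X3^T X4^T X1^T X2^T Y^T hk2 hk1.
  have {Au} Au : (Amat X1 X2 X3 X4 Y)^T *m uvec R k1 p = s *: vvec R k2 q <->
      (const_mx 1 : 'rV[R]_k1) *m X1 = (const_mx 1 : 'rV[R]_k1) *m X2.
    have -> : uvec R k1 p = - vvec R k1 p by rewrite vvecE opprK.
    rewrite tr_Amat [vvec R k2 q]vvecE mulmxN scalerN.
    rewrite /s mulrC; split.
      move/oppr_inj/Au/(congr1 trmx); rewrite !trmx_mul !trmxK trmx_const; exact.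
    move=> /(congr1 trmx); rewrite !trmx_mul trmx_const => /Au ->; exact.
  have := gram_rank1_singular_pair (Amat X1 X2 X3 X4 Y) (lt0r_neq0 s0) u1 v1.
  rewrite /= -EE => sp; split.
    by case=> _ _ _ e1 e2; have [_ _ /Av ? /Au ?] := proj1 sp (conj e1 e2).
  case=> /Au e1 /Av e2.
  have /sp[] : singular_pair (Amat X1 X2 X3 X4 Y) s (uvec R k1 p) (vvec R k2 q) by split.
  by split.
split; first exact: part1.
have via_sym A B : gram_mates_via E A B -> gram_mates_via E B A.
  case=> -[A01 B01 AB AAT ATA] AmB; split; first by split; rewrite // eq_sym.
  by rewrite -opprB; case: AmB => ->; rewrite ?opprK; auto.
have conv A B : gram_mates_via E A B -> convertible A B.
  case/(gram_mates_viaP hk1 hk2) => v [_ AB Auv].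
  by rewrite -[B](subKr A) AB; apply: singular_pair_convertible.
split; [|split].
- split.
  + apply/is01m1_block; split=> [|i j|i j|i j]; try by rewrite mxE; left.
    by apply/is01m1_block; split=> i j; rewrite !mxE; auto.
  + have -> : (const_mx 1 : 'cV[R]_(k2 + k2 + q)) =
        col_mx (col_mx (const_mx 1) (const_mx 1)) (const_mx 1).
      by rewrite !col_mx_const.
    rewrite /E /Emat !mul_block_col !mul0mx !addr0 !mulNmx addNr subrr.
    by rewrite !col_mx0.
  + have -> : (const_mx 1 : 'rV[R]_(k1 + k1 + p)) =
        row_mx (row_mx (const_mx 1) (const_mx 1)) (const_mx 1).
      by rewrite !row_mx_const.
    rewrite /E /Emat !mul_row_block !mulmx0 !addr0 !mulmxN addNr subrr.
    by rewrite !row_mx0.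
  (* With all free blocks zero, the sum conditions of the first assertion hold trivially. *)
  + exists (Amat 0 0 0 0 0); apply/part1 => //.
    rewrite /Amat col_mx0 row_mx0.
    apply/is01_block; split=> [|i j|i j|i j]; try by rewrite mxE; left.
    by apply/is01_block; split=> i j; rewrite mxE; auto.
- by move=> A B AB; split; apply: conv => //; apply: via_sym.
- move=> A B /(gram_mates_viaP hk1 hk2) [v [vE AB [_ vv _ _]]] U Sig V S.
  case/(svd_conversion_rank1 s0 u1 vv AB) => i [Si [j [ji [Sij [Ui Vj]]]]].
  exists i; split=> //; exists j; do 3!split=> //.
  by case: vE Vj => -> [] ->; rewrite ?opprK; auto.
Qed.
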